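(* Let $(X,\tau_X,\mathfrak{a})$ and $(Y,\tau_Y,\mathfrak{b})$ be transitive aura topological spaces. Then the product aura space $(X\times Y,\tau_X\times\tau_Y,\mathfrak{a}\times\mathfrak{b})$ is $(\mathfrak{a}\times\mathfrak{b})$-compact if and only if $(X,\tau_X,\mathfrak{a})$ is $\mathfrak{a}$-compact and $(Y,\tau_Y,\mathfrak{b})$ is $\mathfrak{b}$-compact.
   Context: An aura topological space $(X,\tau,\mathfrak{a})$ is a topological space $(X,\tau)$ together with a function $\mathfrak{a}:X\to\tau$ (a scope function) such that $x\in\mathfrak{a}(x)$ for every $x\in X$. It is transitive if $y\in\mathfrak{a}(x)$ implies $\mathfrak{a}(y)\subseteq\mathfrak{a}(x)$ for all $x,y\in X$. A subset $A\subseteq X$ is $\mathfrak{a}$-open if $\mathfrak{a}(x)\subseteq A$ for every $x\in A$; the collection $\tau_{\mathfrak{a}}$ of all $\mathfrak{a}$-open sets is a topology on $X$ with $\tau_{\mathfrak{a}}\subseteq\tau$. The space is $\mathfrak{a}$-compact if every cover of $X$ by members of $\tau_{\mathfrak{a}}$ has a finite subcover. The product aura space of $(X,\tau_X,\mathfrak{a})$ and $(Y,\tau_Y,\mathfrak{b})$ is $(X\times Y,\tau_X\times\tau_Y,\mathfrak{a}\times\mathfrak{b})$, where $\tau_X\times\tau_Y$ is the product topology and $(\mathfrak{a}\times\mathfrak{b})(x,y)=\mathfrak{a}(x)\times\mathfrak{b}(y)$; thus $\tau_{\mathfrak{a}\times\mathfrak{b}}$ consists of all $W\subseteq X\times Y$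 with $\mathfrak{a}(x)\times\mathfrak{b}(y)\subseteq W$ for every $(x,y)\in W$, and $(\mathfrak{a}\times\mathfrak{b})$-compactness is defined using covers by members of $\tau_{\mathfrak{a}\times\mathfrak{b}}$.
   Formalization: The spaces X and Y are assumed nonempty; otherwise the claim fails, e.g. for X empty and Y infinite discrete with b(y) = {y}, where the product is empty and hence compact but Y is not b-compact. *)

(* Defs.v *)
From HB Require Import structures.
From mathcomp Require Import all_boot.
From mathcomp Require Import boolp classical_sets filter topology.

Set Implicit Arguments.
Unset Strict Implicit.
Unset Printing Implicit Defensive.

Local Open Scope classical_set_scope.

(* An aura topological space (X, tau, a) is a topologicalType X together with
   an element a of scopeFunction X. *)
Record scopeFunction (X : topologicalType) := ScopeFunction {
  scope_fun :> X -> set X ;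
  scope_open : forall x, open (scope_fun x) ;
  scope_mem : forall x, scope_fun x x }.

Definition aura_transitive (X : topologicalType) (a : scopeFunction X) : Prop :=
  forall x y, a x y -> a y `<=` a x.

Definition aura_open (X : topologicalType) (a : scopeFunction X) : set (set X) :=
  [set A | forall x, A x -> a x `<=` A].

Lemma aura_openT (X : topologicalType) (a : scopeFunction X) :
  aura_open a setT.
Proof. by []. Qed.

Lemma aura_openI (X : topologicalType) (a : scopeFunction X) :
  setI_closed (aura_open a).
Proof. by move=> A B oA oB x [Ax Bx] y axy; split; [exact: oA axy|exact: oB axy]. Qed.

Lemma aura_open_bigU (X : topologicalType) (a : scopeFunction X) (I : Type)
    (f : I -> set X) :
  (forall i, aura_open a (f i)) -> aura_open a (\bigcup_i f i).
Proof. by move=> of_ x [i _ fix_] y axy; exists i => //; exact: of_ axy. Qed.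

(* A copy of X carrying the topology tau_a of a-open sets in place of tau. *)
Definition aura_space (X : topologicalType) (a : scopeFunction X) : Type := X.

HB.instance Definition _ (X : topologicalType) (a : scopeFunction X) :=
  Choice.on (aura_space a).
HB.instance Definition _ (X : topologicalType) (a : scopeFunction X) :=
  isOpenTopological.Build (aura_space a)
    (@aura_openT X a) (@aura_openI X a) (@aura_open_bigU X a).

Lemma aura_space_openE (X : topologicalType) (a : scopeFunction X) :
  (open : set (set (aura_space a))) = aura_open a.
Proof. by []. Qed.

Lemma aura_open_open (X : topologicalType) (a : scopeFunction X) :
  aura_open a `<=` open.
Proof.
move=> A oA; rewrite openE => x Ax; rewrite /interior.
apply: filterS (oA x Ax) _; apply: open_nbhs_nbhs.
by split; [exact: scope_open|exact: scope_mem].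
Qed.

Definition aura_compact (X : topologicalType) (a : scopeFunction X) : Prop :=
  cover_compact [set: aura_space a].

Lemma prod_scope_open (X Y : topologicalType) (a : scopeFunction X)
    (b : scopeFunction Y) (p : X * Y) : open (a p.1 `*` b p.2).
Proof.
rewrite openE => -[x y] [/= ax bx]; rewrite /interior.
exists (a p.1, b p.2) => //=; split; apply: open_nbhs_nbhs;
  by split => //; exact: scope_open.
Qed.

Lemma prod_scope_mem (X Y : topologicalType) (a : scopeFunction X)
    (b : scopeFunction Y) (p : X * Y) : (a p.1 `*` b p.2) p.
Proof. by split; exact: scope_mem. Qed.

(* X * Y carries the product topology, through its canonical instance. *)
Definition prod_scope (X Y : topologicalType) (a : scopeFunction X)
    (b : scopeFunction Y) : scopeFunction (X * Y)%type :=
  @ScopeFunction (X * Y)%type (fun p => a p.1 `*` b p.2)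
    (@prod_scope_open X Y a b) (@prod_scope_mem X Y a b).

(* Main.v *)
(* Under transitivity each a(x) is itself a-open, and it is the least a-open set
   containing x.  Hence a-compactness just says that X is a finite union of sets
   a(x), a condition which passes to finite products and to projections. *)
Require Import Defs.
From mathcomp Require Import all_boot finmap.
From mathcomp Require Import boolp classical_sets filter topology.

Local Open Scope classical_set_scope.

Lemma aura_open_scope (X : topologicalType) (a : scopeFunction X) (x : X) :
  aura_transitive a -> aura_open a (a x).
Proof. by move=> atr y; exact: atr. Qed.

Lemma prod_scope_transitive (X Y : topologicalType)
    (a : scopeFunction X) (b : scopeFunction Y) :
  aura_transitive a -> aura_transitive b -> aura_transitive (prod_scope a b).
Proof.
move=> atr btr p q [apq bpq] r [aqr bqr].
by split; [exact: atr apq _ aqr|exact: btr bpq _ bqr].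
Qed.

Lemma aura_compactP (X : topologicalType) (a : scopeFunction X) :
  aura_transitive a ->
  aura_compact a <->
  exists F : {fset X}, forall x, exists2 s, s \in F & a s x.
Proof.
move=> atr; split=> [cX|[F Fcover] I D f fop Dcover].
  (* Compactness is tested on the cover by all scopes, indexed by the points themselves, so a finite
     subcover is a finite set of points. *)
  have [|x _|F _ Fcover] := cX X setT (fun x => a x).
  - by move=> x _; exact: aura_open_scope.
  - by exists x => //; exact: scope_mem.
  by exists F => x; have [s sF asx] := Fcover x I; exists s.
(* [g s] indexes a cover member containing [s]; being a-open, that member contains all of [a s]. *)
have /choice[g gP] : forall s : X, exists i, D i /\ f i s.
  by move=> s; have [i Di fis] := Dcover s Logic.I; exists i.
exists [fset g s | s in F]%fset.
  by move=> _ /imfsetP[s _ ->]; rewrite inE; have [] := gP s.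
move=> x _; have [s sF asx] := Fcover x.
have [Dgs fgs] := gP s.
exists (g s); first exact: in_imfset.
exact: (fop _ Dgs s fgs).
Qed.

Theorem theorem5p13 (X Y : topologicalType)
    (a : scopeFunction X) (b : scopeFunction Y)
    (X_nonempty : [set: X] !=set0) (Y_nonempty : [set: Y] !=set0)
    (a_trans : aura_transitive a) (b_trans : aura_transitive b) :
  aura_compact (prod_scope a b) <-> aura_compact a /\ aura_compact b.
Proof.
rewrite (aura_compactP _ _ a_trans) (aura_compactP _ _ b_trans).
rewrite (aura_compactP _ _ (prod_scope_transitive _ _ _ _ a_trans b_trans)).
split=> [[H Hcover]|[[F Fcover] [G Gcover]]].
  (* Base points lift a point of one factor to the product; with an empty factor the product would
     be compact whatever the other factor is. *)
  have [x0 _] := X_nonempty; have [y0 _] := Y_nonempty; split.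
    exists [fset p.1 | p in H]%fset => x.
    have [p pH [apx _]] := Hcover (x, y0).
    by exists p.1 => //; exact: in_imfset.
  exists [fset p.2 | p in H]%fset => y.
  have [p pH [_ bpy]] := Hcover (x0, y).
  by exists p.2 => //; exact: in_imfset.
(* Product scopes are rectangles, so pairs of centres suffice. *)
exists (F `*` G)%fset => -[x y].
have [s sF asx] := Fcover x; have [t tG bty] := Gcover y.
by exists (s, t); first by rewrite in_fsetM sF.
Qed.
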